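(* Let $\mathcal M=(N,\mathcal I)$ be a loopless matroid and let $S\subseteq N$ be a random set containing each element of $N$ independently with probability $1/2$. Then with probability at least $1/100$, both $\rho_{\mathcal M|S}$ and $\rho_{\mathcal M|(N\setminus S)}$ are $(288,9)$-approximations of $\rho_{\mathcal M}$.
   Context: $\mathcal M|T$ denotes the restriction of $\mathcal M$ to $T\subseteq N$. For a matroid $\mathcal M=(N,\mathcal I)$ with rank function $r$, $D_{\mathcal M}(S,\lambda)$ is the unique inclusion-wise maximal maximizer of $|U|-\lambda r(U)$ over $U\subseteq S$, and the rank-density curve is $\rho_{\mathcal M}(t)=\max\{\lambda\ge0:r(D_{\mathcal M}(N,\lambda))\ge t\}$ for $0<t\le r(N)$, $\rho_{\mathcal M}(t)=0$ for $t>r(N)$. $(\alpha,\beta)$-downshift of a non-increasing $\rho:\mathbb R_{>0}\to\mathbb R_{\ge0}$: let $\phi(t)=\rho(\alpha)/\beta$ for $t\in(0,1]$ and $\phi(t)=\rho(\alpha t)/\beta$ for $t>1$; then $\rho'(t)=1$ if $\phi(t)\in(0,1)$ and $\rho'(t)=\phi(t)$ otherwise. A function $\tilde\rho:\mathbb R_{>0}\to\mathbb R_{\ge0}$ is an $(\alpha,\beta)$-approximation of $\rho$ if it is non-increasing and $\rho'\le\tilde\rho\le\rho$ pointwise. *)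

(* Defs.v *)
From mathcomp Require Import all_boot all_order all_algebra.
From mathcomp Require Import boolp reals.
Set Implicit Arguments. Unset Strict Implicit. Unset Printing Implicit Defensive.
Import Order.TTheory GRing.Theory Num.Theory.
Local Open Scope ring_scope.

Definition is_matroid (T : finType) (N : {set T}) (indep : {set T} -> bool) : Prop :=
  [/\ indep set0,
      (forall I : {set T}, indep I -> I \subset N),
      (forall I J : {set T}, J \subset I -> indep I -> indep J) &
      (forall I J : {set T}, indep I -> indep J -> #|I| < #|J| ->
         exists2 x, x \in J :\: I & indep (x |: I))%N].

Definition loopless (T : finType) (N : {set T}) (indep : {set T} -> bool) : Prop :=
  forall x, x \in N -> indep [set x].

Definition restrict (T : finType) (indep : {set T} -> bool) (S : {set T}) :=
  fun I : {set T} => indep I && (I \subset S).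

Definition rank (T : finType) (indep : {set T} -> bool) (U : {set T}) : nat :=
  \max_(I : {set T} | indep I && (I \subset U)) #|I|.

Section Density.
Variable R : realType.

Definition dens_obj (T : finType) (indep : {set T} -> bool) (lam : R) (U : {set T}) : R :=
  #|U|%:R - lam * (rank indep U)%:R.

Definition is_maximizer (T : finType) (indep : {set T} -> bool) (S : {set T}) (lam : R)
  (U : {set T}) : bool :=
  (U \subset S) &&
  [forall V : {set T}, (V \subset S) ==> (dens_obj indep lam V <= dens_obj indep lam U)].

(* D_M(S, lam): the (unique) inclusion-wise maximal maximizer *)
Definition Dset (T : finType) (indep : {set T} -> bool) (S : {set T}) (lam : R) : {set T} :=
  odflt S [pick U : {set T} | is_maximizer indep S lam U &&
     [forall V : {set T}, (is_maximizer indep S lam V && (U \subset V)) ==> (V == U)]].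

(* rank-density curve of the matroid (N, indep); the max is taken as a sup *)
Definition rho (T : finType) (N : {set T}) (indep : {set T} -> bool) (t : R) : R :=
  if (0 < t) && (t <= (rank indep N)%:R) then
    sup (fun lam : R => 0 <= lam /\ t <= (rank indep (Dset indep N lam))%:R)
  else 0.

Definition downshift (alpha beta : R) (r : R -> R) (t : R) : R :=
  let phi := if t <= 1 then r alpha / beta else r (alpha * t) / beta in
  if (0 < phi) && (phi < 1) then 1 else phi.

Definition approximation (alpha beta : R) (rt r : R -> R) : Prop :=
  (forall s t, 0 < s -> s <= t -> rt t <= rt s) /\
  (forall t, 0 < t -> downshift alpha beta r t <= rt t /\ rt t <= r t).

End Density.

(* Main.v *)
Require Import Defs.
From mathcomp Require Import boolp classical_sets reals.
From mathcomp Require Import all_boot all_order all_algebra.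
From mathcomp Require Import ring lra zify.
Import Order.TTheory GRing.Theory Num.Theory.
Set Implicit Arguments. Unset Strict Implicit. Unset Printing Implicit Defensive.
Local Open Scope ring_scope.

(** Submodularity of the rank makes [D(S, lambda)] monotone in [S], which gives
    everything but the lower bound. That bound fails for [S] only if, for some
    integer [k >= 288], [D(S, mu)] has rank below [k / 288], where
    [mu = max 1 (rho k / 9)]. To bound the probability of this, take a set [E] that
    behaves like a union of [l] disjoint bases of a matroid of rank [k' >= k], where
    [l] is just below [rho k]. The part of [E] inside [D(S, mu)] is spanned by some
    [I] in [E] with [24 |I| <= k], and by maximality of [D(S, mu)] the sample [S]
    meets [E] outside the span of [I] in at most [|E| / 8] elements, instead of the
    expected half. An exponential-moment bound summed over all [I] shows that this
    has probability at most [(19/20)^k], and these bounds sum over [k >= 288], for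
    [S] and for its complement, to at most [1/50]. *)

(** * Matroid rank, spans and tight subsets *)

Section Rank.
Local Open Scope nat_scope.
Variables (T : finType) (N : {set T}) (indep : {set T} -> bool).
Hypothesis matN : is_matroid N indep.
Local Notation r := (rank indep).

Lemma indep_card_le_rank (I U : {set T}) : indep I -> I \subset U -> #|I| <= r U.
Proof. by move=> iI sIU; apply: (@leq_bigmax_cond _ _ (fun I : {set T} => #|I|)); rewrite iI. Qed.

Lemma rank_leP (U : {set T}) n :
  reflect (forall I : {set T}, indep I -> I \subset U -> #|I| <= n) (r U <= n).
Proof.
apply: (iffP idP) => [le_n I iI sIU|H].
  exact: leq_trans (indep_card_le_rank iI sIU) le_n.
by apply/bigmax_leqP => I /andP[]; apply: H.
Qed.

Lemma rankS (U V : {set T}) : U \subset V -> r U <= r V.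
Proof.
move=> sUV; apply/rank_leP => I iI sIU.
exact: indep_card_le_rank iI (subset_trans sIU sUV).
Qed.

Lemma rank_le_card (U : {set T}) : r U <= #|U|.
Proof. by apply/rank_leP => I _; apply: subset_leq_card. Qed.

Lemma rank_indep (I : {set T}) : indep I -> r I = #|I|.
Proof. by move=> iI; apply/eqP; rewrite eqn_leq rank_le_card indep_card_le_rank. Qed.

Lemma basis_extend (I U : {set T}) : indep I -> I \subset U ->
  exists J : {set T}, [/\ I \subset J, J \subset U, indep J & #|J| = r U].
Proof.
case: matN => _ _ _ exch iI sIU.
have [J maxJ sIJ] := @maxset_exists _ (fun J => indep J && (J \subset U)) I
  (introT andP (conj iI sIU)).
have /andP[iJ sJU] := maxsetp maxJ.
exists J; split=> //; apply/eqP; rewrite eqn_leq indep_card_le_rank //=.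
apply/rank_leP => K iK sKU; rewrite leqNgt; apply/negP => ltJK.
have [x /setDP[xK xJ] ixJ] := exch _ _ iJ iK ltJK.
have sxJU : x |: J \subset U by rewrite subUset sub1set (subsetP sKU).
have := maxsetsup maxJ (introT andP (conj ixJ sxJU)) (subsetUr _ _).
by move/setP/(_ x); rewrite !inE eqxx (negPf xJ).
Qed.

Lemma basis_exists (U : {set T}) :
  exists J : {set T}, [/\ J \subset U, indep J & #|J| = r U].
Proof.
have i0 : indep set0 by case: matN.
by have [J []] := basis_extend i0 (sub0set U); exists J.
Qed.

(** A basis [I] of the intersection extends to a basis [J] of the union. The traces of [J] on [A]
    and [B] are independent, cover [J], and share at least [I]. *)
Lemma rank_submod (A B : {set T}) : r (A :|: B) + r (A :&: B) <= r A + r B.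
Proof.
have [I [sI iI cI]] := basis_exists (A :&: B).
have sIU : I \subset A :|: B.
  by apply: subset_trans sI (subset_trans (subsetIl _ _) (subsetUl _ _)).
have [J [sIJ sJ iJ cJ]] := basis_extend iI sIU.
have iJX X : indep (J :&: X) by case: matN => _ _ + _; apply; [exact: subsetIl|].
rewrite -cJ -cI.
have -> : #|J| = #|(J :&: A) :|: (J :&: B)| by rewrite -setIUr (setIidPl sJ).
apply: (@leq_trans (#|J :&: A :|: J :&: B| + #|(J :&: A) :&: (J :&: B)|)).
  by rewrite leq_add2l subset_leq_card // -setIIr subsetI sIJ.
by rewrite cardsUI leq_add // indep_card_le_rank // subsetIr.
Qed.

(** The matroid closure of [I], cut down to [E]. *)
Definition cspan (E I : {set T}) := [set x in E | r (x |: I) == r I].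

(** A larger independent set in the span would, by exchange, add some [x] to a basis of [I],
    although [x] does not raise the rank of [I]. *)
Lemma rank_cspan (E I : {set T}) : r (cspan E I) <= r I.
Proof.
have [J [sJI iJ cJ]] := basis_exists I.
apply/rank_leP => K iK sK; rewrite -cJ leqNgt; apply/negP => ltJK.
case: matN => _ _ _ exch.
have [x /setDP[xK xJ] ixJ] := exch _ _ iJ iK ltJK.
have := subsetP sK _ xK; rewrite inE => /andP[_ /eqP rx].
have := indep_card_le_rank ixJ (setUS _ sJI).
by rewrite rx cardsU1 xJ cJ add1n ltnn.
Qed.

Lemma basis_cspan (E V : {set T}) : V \subset E ->
  exists I : {set T}, [/\ I \subset V, #|I| = r V & V \subset cspan E I].
Proof.
move=> sVE; have [I [sIV iI cI]] := basis_exists V; exists I; split=> //.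
apply/subsetP => x xV; rewrite inE (subsetP sVE) //= eqn_leq (rankS (subsetUr _ _)) andbT.
by rewrite (rank_indep iI) cI rankS // subUset sub1set xV.
Qed.

(* Minimality makes every element avoid some set attaining equality; these sets
   are closed under intersection, so the empty set attains it as well. *)
Lemma tight_subset (l k : nat) (D : {set T}) : 0 < l -> r D = k ->
  (forall V : {set T}, V \subset D -> #|V| + l * k <= #|D| + l * r V) ->
  exists E : {set T}, [/\ E \subset D, #|E| = l * k &
    forall V : {set T}, V \subset E -> #|V| + l * k <= #|E| + l * r V].
Proof.
move=> l_gt0 rD packD.
pose P (E : {set T}) := [forall V : {set T}, (V \subset E) ==>
  (#|V| + l * k <= #|E| + l * r V)].
have PP (E : {set T}) : reflect (forall V : {set T}, V \subset E ->
    #|V| + l * k <= #|E| + l * r V) (P E).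
  by apply: (iffP forallP) => H V; apply/implyP; apply: H.
have [E minE sED] := minset_exists (introT (PP D) packD).
have /PP packE := minsetp minE.
exists E; split=> //.
have rE : r E = k.
  apply/eqP; rewrite eqn_leq -{1}rD rankS //=.
  by have := packE E (subxx _); rewrite leq_add2l leq_pmul2l.
pose tight (V : {set T}) := (V \subset E) && (#|V| + l * k == #|E| + l * r V).
have tightE : tight E by rewrite /tight subxx rE eqxx.
have tightI (A B : {set T}) : tight A -> tight B -> tight (A :&: B).
  move=> /andP[sA /eqP eA] /andP[sB /eqP eB].
  have sI : A :&: B \subset E by apply: subset_trans (subsetIl _ _) sA.
  have sU : A :|: B \subset E by rewrite subUset sA.
  rewrite /tight sI eqn_leq packE //=.
  have := packE _ sU; have := rank_submod A B; have := cardsUI A B.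
  move: eA eB; nia.
have [V0 minV0 _] := minset_exists tightE.
have tV0 := minsetp minV0.
(* Equality at the empty set reads [#|E| = l * k]. Otherwise an element [e] of [V0] yields a smaller
   tight set. *)
have [V00|[e eV0]] := set_0Vmem V0.
  have r0 : r set0 = 0 by apply/eqP; rewrite -leqn0 -(@cards0 T) rank_le_card.
  by move: tV0; rewrite /tight V00 cards0 r0 => /andP[_ /eqP]; lia.
have eE : e \in E by case/andP: tV0 => /subsetP->.
have : ~~ P (E :\ e).
  apply/negP => PEe; have := minsetinf minE PEe (subsetDl _ _).
  by move/setP/(_ e); rewrite !inE eqxx eE.
rewrite negb_forall => /existsP[V]; rewrite negb_imply -ltnNge => /andP[sV ltV].
have sVE := subset_trans sV (subsetDl _ _).
(* The strict inequality for [E :\ e] loses exactly one against [E], so [V] attains equality in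
   [E]. *)
have tV : tight V.
  rewrite /tight sVE eqn_leq packE //=.
  by move: ltV; have := cardsD1 e E; rewrite eE; lia.
have := minsetinf minV0 (tightI _ _ tV0 tV) (subsetIl _ _).
move/setP/(_ e); rewrite inE eV0 /= => eV.
by have := subsetP sV _ eV; rewrite !inE eqxx.
Qed.

End Rank.

(** * Transfer from a restricted matroid to the ambient one *)

Section Restriction.
Variables (R : realType) (T : finType) (indep : {set T} -> bool) (S : {set T}).

Lemma rank_restrict (U : {set T}) : U \subset S ->
  rank (restrict indep S) U = rank indep U.
Proof.
move=> sUS; apply: eq_bigl => I; rewrite /restrict -andbA.
by have [sIU|] := boolP (I \subset U); rewrite ?andbF ?andbT // (subset_trans sIU sUS) andbT.
Qed.

Lemma is_maximizer_restrict (lam : R) (U : {set T}) :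
  is_maximizer (restrict indep S) S lam U = is_maximizer indep S lam U.
Proof.
rewrite /is_maximizer; have [sUS|//] := boolP (U \subset S).
apply: eq_forallb => V; have [sVS|//] := boolP (V \subset S).
by rewrite /dens_obj !rank_restrict.
Qed.

Lemma Dset_restrict (lam : R) : Dset (restrict indep S) S lam = Dset indep S lam.
Proof.
rewrite /Dset; congr (odflt S); apply: eq_pick => U /=.
rewrite is_maximizer_restrict; congr (_ && _).
by apply: eq_forallb => V; rewrite is_maximizer_restrict.
Qed.

Lemma is_maximizerP (lam : R) (U : {set T}) :
  reflect (U \subset S /\ forall V : {set T}, V \subset S ->
     dens_obj indep lam V <= dens_obj indep lam U) (is_maximizer indep S lam U).
Proof.
apply: (iffP andP) => -[sU H]; split=> //; first by move=> V; move/forallP/(_ V)/implyP: H.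
by apply/forallP => V; apply/implyP/H.
Qed.

End Restriction.

(** * Densest sets and the rank-density curve *)

Section Density.
Variables (R : realType) (T : finType) (N : {set T}) (indep : {set T} -> bool).
Hypothesis matN : is_matroid N indep.
Local Notation r := (rank indep).
Implicit Types (S U V : {set T}) (lam mu t : R).

Lemma dens_obj_supermod lam U V : 0 <= lam ->
  dens_obj indep lam U + dens_obj indep lam V <=
  dens_obj indep lam (U :|: V) + dens_obj indep lam (U :&: V).
Proof.
move=> lam0; rewrite /dens_obj.
have /(congr1 (fun n => n%:R : R)) := cardsUI U V; rewrite !natrD => cUV.
have := rank_submod matN U V; rewrite -(ler_nat R) !natrD => rUV.
have := ler_wpM2l lam0 rUV; rewrite !mulrDr; lra.
Qed.

Lemma maximizer_setU S lam U V : 0 <= lam ->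
  is_maximizer indep S lam U -> is_maximizer indep S lam V ->
  is_maximizer indep S lam (U :|: V).
Proof.
move=> lam0 /is_maximizerP[sU mU] /is_maximizerP[sV mV].
have sUV : U :|: V \subset S by rewrite subUset sU.
apply/is_maximizerP; split=> // W sW.
have := dens_obj_supermod U V lam0.
have := mU _ (subset_trans (subsetIl U V) sU); have := mV _ sW; lra.
Qed.

(** Maximizers are closed under union, so an inclusion-wise maximal one contains all the others. *)
Lemma Dset_spec S lam : 0 <= lam -> is_maximizer indep S lam (Dset indep S lam) /\
  forall V, is_maximizer indep S lam V -> V \subset Dset indep S lam.
Proof.
move=> lam0; rewrite /Dset; case: pickP => [U /andP[maxU /forallP supU]|noU] /=.
  split=> // V maxV; have := supU (U :|: V).
  rewrite maximizer_setU //= subsetUl => /eqP <-; exact: subsetUr.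
(* The default value in [Dset] is never reached: a maximizer of largest cardinality is
   inclusion-wise maximal. *)
have [U0 sU0 maxU0] := @arg_maxP _ R _ set0 (fun U => U \subset S)
  (dens_obj indep lam) (sub0set S).
have mU0 : is_maximizer indep S lam U0 by apply/is_maximizerP.
have [U mU supU] := @arg_maxnP _ U0 (is_maximizer indep S lam) (fun U => #|U|) mU0.
have := noU U; rewrite mU /= => /negP[]; apply/forallP => V; apply/implyP => /andP[mV sUV].
by rewrite eq_sym eqEcard sUV; apply: supU.
Qed.

Lemma Dset_sub S lam : 0 <= lam -> Dset indep S lam \subset S.
Proof. by move=> lam0; have [/is_maximizerP[]] := Dset_spec S lam0. Qed.

Lemma Dset_max S lam V : 0 <= lam -> V \subset S ->
  dens_obj indep lam V <= dens_obj indep lam (Dset indep S lam).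
Proof. by move=> lam0 sV; have [/is_maximizerP[_ /(_ V sV)]] := Dset_spec S lam0. Qed.

Lemma sub_Dset S lam V : 0 <= lam -> V \subset S ->
  dens_obj indep lam (Dset indep S lam) <= dens_obj indep lam V ->
  V \subset Dset indep S lam.
Proof.
move=> lam0 sV leV; have [_ supD] := Dset_spec S lam0; apply: supD.
apply/is_maximizerP; split=> // W sW; exact: le_trans (Dset_max lam0 sW) leV.
Qed.

(** With [A] and [B] the two densest sets, [A :&: B] is no better than [A]. By supermodularity
    [A :|: B] is then no worse than [B], which absorbs it. *)
Lemma DsetS S1 S2 lam : 0 <= lam -> S1 \subset S2 ->
  Dset indep S1 lam \subset Dset indep S2 lam.
Proof.
move=> lam0 sS; set A := Dset indep S1 lam; set B := Dset indep S2 lam.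
have sA : A \subset S1 by exact: Dset_sub.
have sB : B \subset S2 by exact: Dset_sub.
apply: subset_trans (subsetUl A B) _; apply: sub_Dset => //.
  by rewrite subUset sB andbT (subset_trans sA).
have := dens_obj_supermod A B lam0.
have := Dset_max lam0 (subset_trans (subsetIl A B) sA); rewrite -/A -/B; lra.
Qed.

Lemma Dset0 S : Dset indep S (0 : R) = S.
Proof.
have sD := Dset_sub S (lexx (0 : R)).
apply/eqP; rewrite eqEsubset sD; apply: sub_Dset => //.
by rewrite /dens_obj !mul0r !subr0 ler_nat subset_leq_card.
Qed.

(** At density 1 an added element gains 1 and costs at most 1, since it raises the rank by at most
    1. *)
Lemma Dset1 S : Dset indep S (1 : R) = S.
Proof.
have sD := Dset_sub S (ler01 : 0 <= 1 :> R).
apply/eqP; rewrite eqEsubset sD; apply: sub_Dset => //.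
set D := Dset indep S (1 : R) in sD *.
have : (r S <= r D + #|S :\: D|)%N.
  have := rank_submod matN D (S :\: D).
  have -> : D :|: (S :\: D) = S.
    by apply/setP => x; rewrite !inE; case: (boolP (x \in D)) => // /(subsetP sD).
  by have := rank_le_card indep (S :\: D); lia.
have := cardsD S D; rewrite (setIidPr sD).
have := subset_leq_card sD.
rewrite /dens_obj !mul1r => leDS cD leS.
have : (#|D| + r S <= #|S| + r D)%N by lia.
by rewrite -(ler_nat R) !natrD; lra.
Qed.

(** Comparison with the empty set gives [lam * r D <= #|D|], where [r D] is at least 1. This bounds
    the set whose supremum defines the curve. *)
Lemma le_card_Dset S lam t : 0 <= lam -> 0 < t -> t <= (r (Dset indep S lam))%:R ->
  lam <= #|S|%:R.
Proof.
move=> lam0 t0; set D := Dset indep S lam => tD.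
have r1 : (1 <= r D)%N by rewrite -(ltr_nat R); apply: lt_le_trans tD.
have := Dset_max lam0 (sub0set S); rewrite /dens_obj -/D cards0.
have -> : r set0 = 0%N by apply/eqP; rewrite -leqn0 -(@cards0 T) rank_le_card.
have cD : #|D|%:R <= #|S|%:R :> R by rewrite ler_nat subset_leq_card ?Dset_sub.
move: r1; rewrite -(ler_nat R) => /(ler_wpM2l lam0); lra.
Qed.

Definition rho_set S t : set R :=
  fun lam => 0 <= lam /\ t <= (r (Dset indep S lam))%:R.

Lemma rho_set_has_sup S t : 0 < t -> t <= (r S)%:R -> has_sup (rho_set S t).
Proof.
move=> t0 tS; split; first by exists 0; split; rewrite ?Dset0.
by exists #|S|%:R => lam [lam0]; apply: le_card_Dset.
Qed.

Lemma rho_restrict S t : rho S (restrict indep S) t = rho S indep t.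
Proof.
rewrite /rho rank_restrict //; case: ifP => // _; congr sup.
apply: funext => lam; rewrite Dset_restrict; apply: propext.
by split=> -[lam0]; rewrite rank_restrict ?Dset_sub.
Qed.

Lemma le_rho S t lam : 0 < t -> 0 <= lam -> t <= (r (Dset indep S lam))%:R ->
  lam <= rho S indep t.
Proof.
move=> t0 lam0 tD.
have tS : t <= (r S)%:R by rewrite (le_trans tD) // ler_nat rankS ?Dset_sub.
by rewrite /rho t0 tS; apply: (sup_upper_bound (rho_set_has_sup t0 tS)).
Qed.

(** A witness [mu] close to the supremum serves wherever an attained maximum would be used. *)
Lemma rho_gt S t lam : 0 <= lam -> lam < rho S indep t ->
  [/\ 0 < t, t <= (r S)%:R & exists mu, [/\ lam < mu, mu <= rho S indep t &
     t <= (r (Dset indep S mu))%:R]].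
Proof.
move=> lam0; rewrite {1}/rho; case: ifP => [/andP[t0 tS]|_]; last by rewrite ltNge lam0.
move=> lt; split=> //.
have [|mu [mu0 tmu] ltmu] := sup_adherent _ (rho_set_has_sup t0 tS) (eps := rho S indep t - lam).
  by rewrite /rho t0 tS subr_gt0.
exists mu; split=> //; last exact: le_rho.
by move: ltmu; rewrite /rho t0 tS /= -/(rho_set S t) subKr.
Qed.

Lemma rho_ge0 S t : 0 <= rho S indep t.
Proof.
rewrite /rho; case: ifP => // /andP[t0 tS].
apply: (sup_upper_bound (rho_set_has_sup t0 tS)).
by split=> //; rewrite Dset0.
Qed.

Lemma rho_le S1 S2 s t : 0 < s -> s <= t -> S1 \subset S2 ->
  rho S1 indep t <= rho S2 indep s.
Proof.
move=> s0 st sS; rewrite leNgt; apply/negP => /(rho_gt (rho_ge0 _ _)).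
move=> [t0 _ [mu [ltmu _ tmu]]].
have mu0 : 0 <= mu by rewrite (le_trans (rho_ge0 S2 s)) // ltW.
move: ltmu; rewrite ltNge => /negP; apply; apply: le_rho => //.
by rewrite (le_trans st) // (le_trans tmu) // ler_nat rankS // DsetS.
Qed.

End Density.

(** * Exponential-moment counting of subsets *)

Section Counting.
Variables (R : realType) (T : finType).
Implicit Types (E I N S V W : {set T}).

Lemma sum_subset_expX N W (x : R) : W \subset N ->
  \sum_(S : {set T} | S \subset N) x ^+ #|S :&: W| = 2 ^+ #|N| * ((1 + x) / 2) ^+ #|W|.
Proof.
move=> sWN.
(* Since [F] vanishes outside [N], expanding the product keeps only the subsets of [N]. The factors
   are [1 + x] on [W], 2 on the rest of [N], and 1 elsewhere. *)
pose F i : R := if i \in N then (if i \in W then x else 1) else 0.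
transitivity (\prod_i (F i + 1)).
  rewrite bigA_distr /= [LHS]big_mkcond /=; apply: eq_bigr => S _.
  case: ifP => [sSN|/negbT/subsetPn[i iS iN]].
    rewrite -big_mkcond /= -[LHS]mulr1; rewrite -prodr_const.
    rewrite (eq_bigr (fun i => if i \in W then x else 1)); last first.
      by move=> i iS; rewrite /F (subsetP sSN).
    rewrite -big_mkcondr mulr1; apply: eq_bigl => i; by rewrite inE.
  by rewrite (bigD1 i) //= iS /F (negPf iN) mul0r.
rewrite (bigID (mem N)) /= [X in _ * X]big1 ?mulr1; last first.
  by move=> i iN; rewrite /F (negPf iN) add0r.
rewrite (bigID (mem W)) /=.
rewrite (eq_bigr (fun=> 1 + x)); last first.
  by move=> i /andP[iN iW]; rewrite /F iN iW addrC.
rewrite [X in _ * X](eq_bigr (fun=> 2)); last first.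
  by move=> i /andP[iN iW]; rewrite /F iN (negPf iW).
rewrite !prodr_const.
have -> : #|[pred i in N | i \in W]| = #|W|.
  apply: eq_card => i; rewrite !inE /=.
  by have [/(subsetP sWN) ->|] := boolP (i \in W); rewrite ?andbF.
have -> : #|[pred i in N | i \notin W]| = (#|N| - #|W|)%N.
  rewrite -{2}(setIidPr sWN) -cardsD; apply: eq_card => i; rewrite !inE /=.
  by rewrite andbC.
have <- := subnK (subset_leq_card sWN); rewrite addnK exprD -mulrA mulrC -exprMn.
by congr (_ * _ ^+ _); lra.
Qed.

(** After raising both sides to the power 24, it comes down to [(5/8)^23 <= (16/25)^24]. *)
Lemma pow_decay (n w : nat) : (23 * n <= 24 * w)%N -> (5 / 8 : R) ^+ w <= (16 / 25) ^+ n.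
Proof.
move=> le_nw.
have h0 : 0 <= (5 / 8 : R) ^+ w by rewrite exprn_ge0 //; lra.
have h1 : 0 <= (16 / 25 : R) ^+ n by rewrite exprn_ge0 //; lra.
rewrite -(@ler_pXn2r _ 24) // -!exprM [(w * 24)%N]mulnC.
apply: le_trans (_ : (5 / 8 : R) ^+ (23 * n) <= _).
  by rewrite ler_wiXn2l //; lra.
by rewrite [(n * 24)%N]mulnC !exprM lerXn2r ?nnegrE ?exprn_ge0 //; lra.
Qed.

(* An exponential-moment bound: a pair (S, I) counted below has
   (6/5)^n (1/4)^|S :&: W I| >= 1, since (6/5)^8 >= 4, and
   (6/5)^k (1/64)^|I| >= 1, since (6/5)^24 >= 64. *)
Lemma card_sparse_le N E (W : {set T} -> {set T}) (k : nat) :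
  E \subset N -> (k <= #|E|)%N -> (forall I, W I \subset E) ->
  (forall I, I \subset E -> (24 * #|I| <= k)%N -> (23 * #|E| <= 24 * #|W I|)%N) ->
  #|[set S : {set T} | (S \subset N) && [exists I : {set T},
      [&& I \subset E, 24 * #|I| <= k & 8 * #|S :&: W I| <= #|E|]%N]]|%:R
    <= (19 / 20) ^+ k * 2 ^+ #|N| :> R.
Proof.
move=> sEN le_kn sWE largeW; set n := #|E| in le_kn largeW *.
have c8 : 4 <= (6 / 5 : R) ^+ 8 by lra.
have c24 : 64 <= (6 / 5 : R) ^+ 24 by lra.
have weight (x y : R) m p q : 0 < x -> 1 <= y -> x^-1 <= y ^+ p -> (p * m <= q)%N ->
    1 <= y ^+ q * x ^+ m.
  move=> x0 y1 xy pmq.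
  have y0 : 0 <= y by lra.
  have : 1 <= y ^+ (p * m) * x ^+ m.
    rewrite exprM -exprMn exprn_ege1 //.
    by rewrite -(mulVf (lt0r_neq0 x0)) ler_wpM2r // ltW.
  move/le_trans; apply; rewrite ler_wpM2r ?exprn_ge0 ?(ltW x0) //.
  by rewrite ler_weXn2l.
pose w S I : R := (6 / 5) ^+ n * (1 / 4) ^+ #|S :&: W I| * ((6 / 5) ^+ k * (1 / 64) ^+ #|I|).
have w0 S I : 0 <= w S I by rewrite /w !mulr_ge0 ?exprn_ge0 //; lra.
apply: le_trans (_ : \sum_(S : {set T} | S \subset N)
    \sum_(I : {set T} | (I \subset E) && (24 * #|I| <= k)%N) w S I <= _).
  rewrite -sum1_card natr_sum big_mkcond [leRHS]big_mkcond; apply: ler_sum => S _.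
  rewrite inE; case: (S \subset N) => //=.
  case: existsP => [[I /and3P[sI cI cS]]|_]; last by apply: sumr_ge0.
  rewrite (bigD1 I) ?sI //=; apply: le_trans (_ : w S I <= _); last first.
    by rewrite lerDl sumr_ge0.
  have h1 : 1 <= (6 / 5) ^+ n * (1 / 4) ^+ #|S :&: W I| :> R.
    by apply: (weight _ _ _ 8) => //; lra.
  have h2 : 1 <= (6 / 5) ^+ k * (1 / 64) ^+ #|I| :> R.
    by apply: (weight _ _ _ 24) => //; lra.
  rewrite /w -[leLHS]mulr1; apply: ler_pM => //; lra.
rewrite exchange_big /=.
(* The bound on [#|I|] is used here to make [W I] large, then dropped. Writing [I :&: E] for [I]
   lets the same product formula sum over all [I]. *)
apply: le_trans (_ : \sum_(I : {set T} | I \subset E)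
   (6 / 5) ^+ n * (2 ^+ #|N| * (16 / 25) ^+ n) * (6 / 5) ^+ k * (1 / 64) ^+ #|I :&: E| <= _).
  rewrite big_mkcondr; apply: ler_sum => I sI /=; case: ifP => [cI|_]; last first.
    by rewrite !mulr_ge0 ?exprn_ge0 //; lra.
  rewrite -mulr_suml -mulr_sumr sum_subset_expX; last exact: subset_trans (sWE I) sEN.
  rewrite (setIidPl sI) -!mulrA ler_wpM2l ?exprn_ge0 //; first lra.
  rewrite ler_wpM2l ?exprn_ge0 // ler_wpM2r ?mulr_ge0 ?exprn_ge0 //; try lra.
  have -> : (1 + 1 / 4) / 2 = 5 / 8 :> R by lra.
  exact/pow_decay/largeW.
rewrite -mulr_sumr sum_subset_expX // -/n.
have -> : (6 / 5) ^+ n * (2 ^+ #|N| * (16 / 25) ^+ n) * (6 / 5) ^+ k *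
   (2 ^+ n * ((1 + 1 / 64) / 2) ^+ n) =
   (6 / 5 * (16 / 25) * 2 * ((1 + 1 / 64) / 2)) ^+ n * (6 / 5) ^+ k * 2 ^+ #|N| :> R.
  rewrite [RHS]mulrAC [(_ * 2 * _) ^+ n]exprMn [(_ * 2) ^+ n]exprMn [(_ * (16 / 25)) ^+ n]exprMn.
  ring.
rewrite ler_wpM2r ?exprn_ge0 //.
(* The base is 0.78, below 1, so the exponent [n] may be lowered to [k]. Then 0.78 times 6/5 is
   0.936, below 19/20. *)
apply: le_trans (_ : (6 / 5 * (16 / 25) * 2 * ((1 + 1 / 64) / 2)) ^+ k * (6 / 5) ^+ k <= _).
  rewrite ler_wpM2r ?exprn_ge0 ?ler_wiXn2l //; lra.
by rewrite -exprMn lerXn2r ?nnegrE //; lra.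
Qed.

End Counting.

Lemma nat_ceil_exists (R : realType) (x : R) :
  exists k : nat, x <= k%:R /\ forall m : nat, x <= m%:R -> (k <= m)%N.
Proof.
have ex : exists m : nat, x <= m%:R.
  by exists (Num.bound `|x|); rewrite (le_trans (ler_norm _)) // ltW // archi_boundP.
by case: (ex_minnP ex) => k xk mink; exists k.
Qed.

(** * Bad samples, their probability, and the approximation *)

Section Sampling.
Variables (R : realType) (T : finType) (N : {set T}) (indep : {set T} -> bool).
Hypothesis matN : is_matroid N indep.
Local Notation r := (rank indep).
Implicit Types (E I S V : {set T}).

(** The maximum with 1 reflects that the downshift raises values in (0,1) to 1. *)
Definition level (k : nat) : R := Num.max 1 (rho N indep (k%:R : R) / 9).

Lemma level_ge0 k : 0 <= level k.
Proof. by rewrite /level le_max ler01. Qed.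

(* The counting condition on E is the one satisfied by a union of l disjoint
   bases of a matroid of rank k'. *)
Lemma packing_exists (k : nat) : (k <= r N)%N ->
  exists E l k', [/\ E \subset N, 0 < l /\ #|E| = l * k', k <= k',
    forall V, V \subset E -> #|V| + l * k' <= #|E| + l * r V &
    forall S, 8 * #|(S :&: E) :\: Dset indep S (level k)| <= #|E|]%N.
Proof.
(* When [rho k] is at most 9, the level is 1 and the densest set of [S] is [S] itself, so a single
   basis of [N] serves as [E]. *)
move=> kN; have [le9|gt9] := leP (rho N indep (k%:R : R)) 9.
  have [J [sJN iJ cJ]] := basis_exists matN N.
  exists J, 1%N, (r N); split=> //; first by split; rewrite ?mul1n.
    move=> V sVJ; rewrite !mul1n cJ [r V]rank_indep ?(addnC #|V|) //.
    by case: matN => _ _ indepS _; apply: indepS sVJ iJ.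
  move=> S; have -> : level k = 1 by rewrite /level; apply/max_idPl; lra.
  rewrite (Dset1 R matN).
  suff -> : S :&: J :\: S = set0 by rewrite cards0.
  by apply/setP => x; rewrite !inE; case: (x \in S).
(* Here [l] is the ceiling of [rho k] minus one: strictly below [rho k], hence below some admissible
   [mu], and at least 9. *)
have [m [le_m min_m]] := nat_ceil_exists (rho N indep (k%:R : R)).
case: m le_m min_m => [|l] le_l min_l; first lra.
have lt_l : l%:R < rho N indep (k%:R : R).
  by rewrite ltNge; apply/negP => /min_l; rewrite ltnn.
have l9 : (9 <= l)%N.
  by have := lt_le_trans gt9 le_l; rewrite ltr_nat.
have [k0 _ [mu [lmu _]]] := rho_gt matN (ler0n R l) lt_l.
have mu0 : 0 <= mu by rewrite (le_trans _ (ltW lmu)).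
set D := Dset indep N mu; rewrite ler_nat => kD.
(* Maximality of [D] at [mu] gives [mu * (r D - r V) <= #|D| - #|V|], and [l < mu]. *)
have packD V : V \subset D -> (#|V| + l * r D <= #|D| + l * r V)%N.
  move=> sVD; have rVD := rankS indep sVD.
  have := Dset_max matN mu0 (subset_trans sVD (Dset_sub matN N mu0)); rewrite -/D /dens_obj.
  have : l%:R * ((r D)%:R - (r V)%:R) <= mu * ((r D)%:R - (r V)%:R) :> R.
    by rewrite ler_wpM2r ?(ltW lmu) // subr_ge0 ler_nat.
  by rewrite -(ler_nat R) !natrD !natrM !mulrBr; lra.
have [|E [sED cE packE]] := tight_subset matN _ erefl packD; first lia.
have sEN : E \subset N := subset_trans sED (Dset_sub matN N mu0).
exists E, l, (r D); split=> //; first by split=> //; lia.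
move=> S.
set A := Dset indep S (level k); set X := S :&: E.
have sAS : A \subset S by apply: Dset_sub; [exact: matN|exact: level_ge0].
have sAX : A :|: X \subset S by rewrite subUset sAS subsetIl.
(* Adding [X] to [A] cannot improve the objective, so [X :\: A] has at most [level k * r D]
   elements, which is at most [#|E| / 8]. *)
have := Dset_max matN (level_ge0 k) sAX; rewrite -/A /dens_obj.
have rAX : (r (A :|: X) <= r A + r D)%N.
  have := rank_submod matN A X.
  have := rankS indep (subset_trans (subsetIr S E) sED); rewrite -/X; lia.
have cAX : #|A :|: X| = (#|A| + #|X :\: A|)%N.
  by have := cardsUI A X; have := cardsID A X; rewrite [X :&: A]setIC; lia.
rewrite cAX natrD.
have lev : level k * ((r (A :|: X))%:R - (r A)%:R) <= level k * (r D)%:R.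
  rewrite ler_wpM2l ?level_ge0 // lerBlDl -natrD ler_nat; exact: rAX.
(* Since [rho k <= l + 1], this needs [(l + 1) / 9 <= l / 8], true from [l = 8] on. *)
have lev8 : 8 * level k <= l%:R.
  have l9R : 9 <= l%:R :> R by rewrite (ler_nat _ 9).
  move: le_l; rewrite -natr1 /level => le_l.
  suff : Num.max 1 (rho N indep (k%:R : R) / 9) <= l%:R / 8 by lra.
  by rewrite ge_max; apply/andP; split; lra.
move=> leA; rewrite -(ler_nat R) cE !natrM.
have := ler_wpM2r (ler0n R (r D)) lev8.
by move: lev; rewrite mulrBr; lra.
Qed.

Lemma card_bad_le (k : nat) : (k <= r N)%N ->
  #|[set S : {set T} | (S \subset N) && (288 * r (Dset indep S (level k)) < k)%N]|%:R
    <= (19 / 20) ^+ k * 2 ^+ #|N| :> R.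
Proof.
move=> kN; have [E [l [k' [sEN [l_gt0 cE] kk' packE sparse]]]] := packing_exists kN.
have kE : (k <= #|E|)%N by rewrite cE; nia.
apply: le_trans (card_sparse_le R (W := fun I => E :\: cspan indep E I) sEN kE _ _).
- rewrite ler_nat subset_leq_card //; apply/subsetP => S.
  rewrite !inE => /andP[-> bad] /=; set A := Dset _ _ _ in bad.
  have [I [sIV cI sVI]] := basis_cspan matN (subsetIr A E).
  apply/existsP; exists I; apply/and3P; split.
  + exact: subset_trans sIV (subsetIr _ _).
  + by have := rankS indep (subsetIl A E); lia.
  + apply: leq_trans (sparse S); rewrite leq_mul2l subset_leq_card //.
    apply/subsetP => x; rewrite !inE => /and3P[xS nsp xE]; rewrite xS xE !andbT -/A.
    apply: contra nsp => xA; have := subsetP sVI x.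
    by rewrite !inE xA xE /=; apply.
- by move=> I; apply: subsetDl.
(* The packing condition on the span [C] of [I] gives [#|C| <= l * r C <= l * #|I|], hence
   [24 * #|C| <= l * k' = #|E|]. *)
- move=> I sIE cI; have sCE : cspan indep E I \subset E.
    by apply/subsetP => x; rewrite inE => /andP[].
  have := rank_cspan matN E I; have := rank_le_card indep I.
  have := cardsD E (cspan indep E I); rewrite (setIidPr sCE) => -> rI rC.
  have := packE _ sCE; have := subset_leq_card sCE; rewrite cE.
  nia.
Qed.

Definition bad S : bool :=
  [exists k : 'I_(r N).+1, (288 <= k)%N && (288 * r (Dset indep S (level k)) < k)%N].

Lemma sum_geometric_tail (m : nat) :
  \sum_(k < m.+1 | (288 <= k)%N) (19 / 20 : R) ^+ k <= 1 / 100.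
Proof.
have -> : \sum_(k < m.+1 | (288 <= k)%N) (19 / 20 : R) ^+ k =
    \sum_(0 <= k < m.+1) (if (288 <= k)%N then (19 / 20) ^+ k else 0).
  by rewrite big_mkord big_mkcond.
(* The factor 20 is [1 / (1 - 19/20)]; the subtracted term is the remaining geometric tail, which
   makes the induction close. *)
have tail n : \sum_(0 <= k < n) (if (288 <= k)%N then (19 / 20 : R) ^+ k else 0) <=
    20 * (19 / 20) ^+ 288 - (if (288 <= n)%N then 20 * (19 / 20) ^+ n else 0).
  have q288 : 0 <= (19 / 20 : R) ^+ 288 by rewrite exprn_ge0 //; lra.
  elim: n => [|n IH]; first by rewrite big_geq //=; lra.
  rewrite big_nat_recr //=.
  have [le_n|lt_n|<-] := ltngtP 287 n.
  - by move: IH; rewrite le_n ltnW // [_ ^+ n.+1]exprS; lra.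
  - have h0 : (288 <= n)%N = false by lia.
    have h1 : (288 <= n.+1)%N = false by lia.
    by move: IH; rewrite h0 h1; lra.
  - rewrite big_mkord big1 ?add0r /=; first lra.
    by move=> i _; rewrite ltnNge (ltnW (ltn_ord i)).
apply: le_trans (tail _) _.
(* The power 288 is reached as [32 * 9], and [20 / 5^9] is well below 1/100. *)
have q32 : (19 / 20 : R) ^+ 32 <= 1 / 5 by lra.
have : ((19 / 20 : R) ^+ 32) ^+ 9 <= (1 / 5) ^+ 9.
  by rewrite lerXn2r ?nnegrE ?exprn_ge0 //; lra.
rewrite -exprM; have -> : (32 * 9 = 288)%N by [].
have : 0 <= (19 / 20 : R) ^+ m.+1 by rewrite exprn_ge0 //; lra.
by case: ifP => _; lra.
Qed.

Lemma card_bad :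
  #|[set S : {set T} | (S \subset N) && bad S]|%:R <= 1 / 100 * 2 ^+ #|N| :> R.
Proof.
apply: le_trans (_ : \sum_(k < (r N).+1 | (288 <= k)%N)
  #|[set S : {set T} | (S \subset N) && (288 * r (Dset indep S (level k)) < k)%N]|%:R <= _).
  rewrite -natr_sum ler_nat.
  under eq_bigr => k _ do rewrite -sum1_card big_mkcond.
  rewrite exchange_big /= -sum1_card big_mkcond; apply: leq_sum => S _; rewrite inE.
  case: (boolP (_ && _)) => // /andP[sS /existsP[k /andP[k288 badk]]].
  by rewrite (bigD1 k) //= inE sS badk.
apply: le_trans (_ : \sum_(k < (r N).+1 | (288 <= k)%N) (19 / 20) ^+ k * 2 ^+ #|N| <= _).
  by apply: ler_sum => k _; apply: card_bad_le; rewrite -ltnS.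
by rewrite -mulr_suml ler_wpM2r ?exprn_ge0 ?sum_geometric_tail.
Qed.

(** Complementation in [N] maps the bad sets onto those with a bad complement, so the union bound
    doubles the count. *)
Lemma card_bad_or_compl :
  #|[set S : {set T} | (S \subset N) && (bad S || bad (N :\: S))]|%:R
    <= 2 / 100 * 2 ^+ #|N| :> R.
Proof.
pose B := [set S : {set T} | (S \subset N) && bad S].
apply: le_trans (_ : (#|B| + #|(fun S => N :\: S) @: B|)%:R <= _); last first.
  apply: le_trans (_ : (#|B| + #|B|)%:R <= _).
    by rewrite ler_nat leq_add2l leq_imset_card.
  by rewrite natrD; have := card_bad; rewrite -/B; lra.
rewrite ler_nat (leq_trans _ (leq_card_setU _ _)) // subset_leq_card //.
apply/subsetP => S; rewrite !inE => /andP[sS /orP[bS|bS]]; first by rewrite sS bS.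
apply/orP; right; apply/imsetP; exists (N :\: S); first by rewrite inE subsetDl.
by rewrite setDDr setDv set0U (setIidPr sS).
Qed.

(** Monotonicity and the upper bound hold for every [S]; only the lower bound uses that [S] is not
    bad, at the ceiling [k] of the argument at which the downshift reads the curve. *)
Lemma good_approximation S : S \subset N -> ~~ bad S ->
  approximation (288 : R) 9 (rho S (restrict indep S)) (rho N indep).
Proof.
move=> sSN /existsPn goodS.
have rhoS (t : R) := rho_restrict matN S t.
split=> [s t s0 st|t t0]; first by rewrite !rhoS; apply: (rho_le matN).
rewrite !rhoS; split; last exact: (rho_le matN).
pose u : R := if t <= 1 then 288 else 288 * t.
have phiE : (if t <= 1 then rho N indep 288 / 9 else rho N indep (288 * t) / 9)
  = rho N indep u / 9 :> R by rewrite /u; case: ifP.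
have u288 : 288 <= u by rewrite /u; case: (leP t 1) => ?; lra.
have tu : 288 * t <= u by rewrite /u; case: (leP t 1) => ?; lra.
rewrite /downshift phiE; set phi := rho N indep u / 9.
have phi_ge0 : 0 <= phi by rewrite divr_ge0 ?(rho_ge0 matN).
have [phi0|phi_gt0] := leP phi 0.
  by rewrite andFb (le_trans phi0) ?(rho_ge0 matN).
suff le_max_rho : Num.max 1 phi <= rho S indep t.
  apply: le_trans le_max_rho; rewrite /= le_max; case: ifP => // _; first by rewrite lexx.
  by rewrite lexx orbT.
have rho_gt0 : 0 < rho N indep u by move: phi_gt0; rewrite /phi; lra.
have [_ uN _] := rho_gt matN (lexx 0) rho_gt0.
have [k [uk min_k]] := nat_ceil_exists u.
have kN : (k <= r N)%N := min_k _ uN.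
have k288 : (288 <= k)%N by rewrite -(ler_nat R) (le_trans u288).
have k0 : 0 < k%:R :> R by rewrite ltr0n; lia.
(* Ranks are integers, so a rank that reaches [u] also reaches its ceiling [k]. *)
have rho_uk : rho N indep u <= rho N indep (k%:R : R).
  rewrite leNgt; apply/negP => /(rho_gt matN (rho_ge0 matN _ _))[_ _ [mu [lt_mu _ u_mu]]].
  have mu0 : 0 <= mu by rewrite (le_trans _ (ltW lt_mu)) ?(rho_ge0 matN).
  move: lt_mu; rewrite ltNge => /negP; apply; apply: (le_rho matN) => //.
  by rewrite ler_nat; apply: min_k.
apply: le_trans (_ : level k <= _).
  by rewrite /level ge_max !le_max lexx /= /phi ler_wpM2r ?orbT // invr_ge0.
apply: (le_rho matN) => //; first exact: level_ge0.
(* The rank at [level k] is at least [k / 288], and [k >= u >= 288 * t]. *)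
have := goodS (Ordinal (kN : (k < (r N).+1)%N)).
rewrite /= k288 /= -leqNgt -(ler_nat R) natrM; lra.
Qed.

End Sampling.

Theorem theorem3p6 (R : realType) (T : finType) (N : {set T})
    (indep : {set T} -> bool) :
  is_matroid N indep -> loopless N indep ->
  (1 / 100 : R) <=
    #|[set S : {set T} | (S \subset N) &&
        `[< approximation (288 : R) 9 (rho S (restrict indep S)) (rho N indep) /\
            approximation (288 : R) 9 (rho (N :\: S) (restrict indep (N :\: S)))
              (rho N indep) >]]|%:R / 2 ^+ #|N|.
Proof.
move=> matN _.
set G := [set S | _].
pose B := [set S : {set T} | (S \subset N) &&
  (bad R N indep S || bad R N indep (N :\: S))].
have sub : powerset N :\: B \subset G.
  apply/subsetP => S; rewrite !inE => /andP[+ sS]; rewrite sS /= negb_or => /andP[gS gNS].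
  by apply/asboolP; split; apply: good_approximation; rewrite ?subsetDl.
(* At most 2/100 of the subsets lie in [B], so [G] holds at least 98/100 of them. *)
have cB := card_bad_or_compl R matN; rewrite -/B in cB.
have le_card : (2 ^ #|N| <= #|G| + #|B|)%N.
  rewrite -card_powerset; apply: leq_trans (_ : #|powerset N :\: B| + #|B| <= _)%N.
    by have := cardsID B (powerset N); have := subset_leq_card (subsetIr (powerset N) B); lia.
  by rewrite leq_add2r subset_leq_card.
move: le_card; rewrite -(ler_nat R) natrD natrX => le_card.
have p0 : 0 < (2 : R) ^+ #|N| by rewrite exprn_gt0.
by rewrite ler_pdivlMr //; lra.
Qed.
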